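(* Let $n>0$. Then: (1) For all $0\le t\le T_n$, $\alpha_{n,t}=\gamma^O_{n,t}=\beta_{n,t}$. (2) If $\pi$ is a permutation of $\{0,\ldots,2^{n(M+1)}-1\}$, then the admissibility of $\pi$ is equivalent to each of the following conditions: (a) for all $\ell<2^{n(M+1)}$, $\mathrm{IWeight}(n,\pi(\ell))=\mathrm{IStep}(n,\ell)$; (b) for all $0\le t\le T_n$, $\pi[\mathrm{I}A_{n,t}]=\mathrm{I}B_{n,t}$; (c) $\mathrm{I}S^*_n=\mathrm{I}S_n\circ\pi$. (3) There are $\prod_{t=0}^{T_n}\left(\gamma^O_{n,t}!\right)$ admissible permutations of $\{0,\ldots,2^{n(M+1)}-1\}$.
   Context: Work in the probability space $(0,1)$ with Lebesgue measure. For $x\in(0,1)$ write $x=\sum_{i\ge1}\varepsilon_i(x)2^{-i}$ with $\varepsilon_i(x)\in\{0,1\}$ and $\varepsilon_i(x)=0$ for infinitely many $i$. Fix an integer $M\ge 0$, put $m=2^{M+1}$, and fix a random variable $O:(0,1)\to\mathbb{R}$ such that $O(x)$ depends bijectively on $(\varepsilon_1(x),\ldots,\varepsilon_{M+1}(x))$. Its $m$ distinct outcomes are enumerated increasingly as $o_1<\cdots<o_m$; they are equally likely, $\sum_s o_s=0$, and $O$ has variance $1$, i.e. $\sum_s o_s^2=m$. Let $\varsigma_s\in\{0,1\}^{M+1}$ be such that $O(x)=o_s$ iff $(\varepsilon_1(x),\ldots,\varepsilon_{M+1}(x))=\varsigma_s$. Arrange the positive integers consecutively, in increasing order, in rows indexed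 by $\rho=1,2,\ldots$, where row $\rho$ has length $b$, the unique positive integer with $(b-1)(M+1)<\rho\le b(M+1)$. Let $J_i$ be the $i$-th column (the set of $i$-th entries of all rows of length $\ge i$), enumerated increasingly as $j_{i,1}<j_{i,2}<\cdots$; let $\overline J_i=\{j_{i,1},\ldots,j_{i,M+1}\}$ and $\overline J^n=\overline J_1\cup\cdots\cup\overline J_n$. Let $P_i(x)$ be the number with $\varepsilon_k(P_i(x))=\varepsilon_{j_{i,k}}(x)$ for all $k$, and $R_i(x)=O(P_i(x))$; that is, for every $x\in(0,1)$, $R_i(x)=o_s$ iff $(\varepsilon_{j_{i,1}}(x),\ldots,\varepsilon_{j_{i,M+1}}(x))=\varsigma_s$. Put $S_n=\sum_{i=1}^n R_i$. The quantile $S^*_n$ of $S_n$ is $S^*_n(x)=\inf\{t\in\mathbb{R}\mid C(t)\ge x\}$ for $x\in(0,1)$, where $C$ is the cumulative distribution function of $S_n$. For $0\le\ell<2^{n(M+1)}$: $D_{n,0}=(0,2^{-n(M+1)})$ and $D_{n,\ell}=[\ell 2^{-n(M+1)},(\ell+1)2^{-n(M+1)})$ for $\ell>0$. Let $(\vec e_\ell\mid 0\le\ell<2^{n(M+1)})$ be the lexicographically increasing enumeration of $\{0,1\}^{\overline J^n}$ (coordinates $\overline J^n$ taken in increasing order), and $E_{n,\ell}=\{x\in(0,1)\mid \varepsilon_j(x)=(\vec e_\ell)_j\text{ for all }j\in\overline J^n\}$. As a standing assumption, $S^*_n$ is taken to be constant on each $D_{n,\ell}$ (the finitely many left endpoints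 of the $D_{n,\ell}$ being disregarded: there $S^*_n$ is taken to have its constant value on the interior of $D_{n,\ell}$); this constant value is denoted $\mathrm{I}S^*_n(\ell)$. $S_n$ is constant on each $E_{n,\ell}$, with value denoted $\mathrm{I}S_n(\ell)$. A permutation $\pi$ of $\{0,\ldots,2^{n(M+1)}-1\}$ is admissible iff for all $0\le\ell<2^{n(M+1)}$: $S^*_n(x)=S_n(y)$ for all $x\in D_{n,\ell}$ and all $y\in E_{n,\pi(\ell)}$. $\mathbf{K}_n$ is the set of $\vec k=(k_1,\ldots,k_m)$ of non-negative integers with sum $n$; $\binom{n}{\vec k}=\frac{n!}{k_1!\cdots k_m!}$; $\vec k\cdot\vec o=k_1o_1+\cdots+k_mo_m$. Let $(v_n^t\mid 0\le t\le T_n)$ be the increasing enumeration of the set of values $\{\vec k\cdot\vec o\mid\vec k\in\mathbf{K}_n\}$ (the values of $S_n$). Put $\overline{\mathbf{K}}_{n,t}=\{\vec k\in\mathbf{K}_n\mid\vec k\cdot\vec o<v_n^t\}$ for $0\le t\le T_n$, and $\overline{\mathbf{K}}_{n,T_n+1}=\mathbf{K}_n$. Then $\mathrm{SMC}^O(n,t)=\sum_{\vec k\in\overline{\mathbf{K}}_{n,t}}\binom{n}{\vec k}$ for $0\le t\le T_n+1$, and $\gamma^O_{n,t}=\mathrm{SMC}^O(n,t+1)-\mathrm{SMC}^O(n,t)$ for $0\le t\le T_n$. For $x\in(0,1)$, $\mathrm{Step}_n(x)$ (respectively $\mathrm{Weight}_n(x)$) is the unique $t$ with $0\le t\le T_n$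 such that $S^*_n(x)=v_n^t$ (respectively $S_n(x)=v_n^t$). $\mathrm{IStep}(n,\ell)$ is the constant value of $\mathrm{Step}_n$ on $D_{n,\ell}$, and $\mathrm{IWeight}(n,\ell)$ is the constant value of $\mathrm{Weight}_n$ on $E_{n,\ell}$. Put $A_{n,t}=\{x\in(0,1)\mid\mathrm{Step}_n(x)=t\}$, $B_{n,t}=\{x\in(0,1)\mid\mathrm{Weight}_n(x)=t\}$, $\mathrm{I}A_{n,t}=\{\ell<2^{n(M+1)}\mid D_{n,\ell}\subseteq A_{n,t}\}$, $\mathrm{I}B_{n,t}=\{\ell<2^{n(M+1)}\mid E_{n,\ell}\subseteq B_{n,t}\}$, $\alpha_{n,t}=|\mathrm{I}A_{n,t}|$, $\beta_{n,t}=|\mathrm{I}B_{n,t}|$. *)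

(* Defs.v *)
From HB Require Import structures.
From mathcomp Require Import all_boot all_order all_algebra perm.
From mathcomp Require Import all_classical all_reals all_analysis.

Set Implicit Arguments.
Unset Strict Implicit.
Unset Printing Implicit Defensive.

Import Order.TTheory GRing.Theory Num.Theory.
Import numFieldNormedType.Exports.

Local Open Scope classical_set_scope.
Local Open Scope ring_scope.

Section ConstantValue.
Variables (A : Type) (B : choiceType).

(* The value of [f] on [D] when [f] is constant on the nonempty set [D];
   [b0] is a junk default. *)
Definition const_value (b0 : B) (D : set A) (f : A -> B) : B :=
  xget b0 [set b | forall x, D x -> f x = b].

End ConstantValue.

Section Digits.
Variable R : realType.
Implicit Type x : R.

Definition unit_interval : set R := [set x | 0 < x < 1].

(* The digit [e i] has weight [2 ^- i], so [e 0] is irrelevant. *)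
Definition binary_expansion x (e : nat -> bool) : Prop :=
  ((fun N : nat => \sum_(1 <= i < N.+1) (e i)%:R * 2 ^- i : R) @ \oo --> x) /\
  (forall N, exists2 i, (N <= i)%N & e i = false).

Definition eps x (i : nat) : bool :=
  xget (fun=> false) [set e | binary_expansion x e] i.

Definition word (d : nat) x (j : nat -> nat) : d.-tuple bool :=
  [tuple eps x (j k.+1) | k < d].

End Digits.

Section OutcomeVariable.
Variables (R : realType) (M : nat) (O : R -> R).
Variables (o : 'I_(2 ^ M.+1) -> R) (vs : 'I_(2 ^ M.+1) -> M.+1.-tuple bool).

Definition depends_bijectively : Prop :=
  exists2 f : M.+1.-tuple bool -> R, injective f &
    forall x, unit_interval x -> O x = f (word M.+1 x id).

Definition increasing_enumeration_of_outcomes : Prop :=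
  {homo o : s t / (s < t)%N >-> s < t} /\ O @` @unit_interval R = range o.

(* That the outcomes are equally likely is a consequence: [vs] is a bijection,
   so each outcome corresponds to one dyadic interval of length 2^-(M+1). *)
Definition words_of_outcomes : Prop :=
  forall x, unit_interval x -> forall s, O x = o s <-> word M.+1 x id = vs s.

End OutcomeVariable.

Section Arrangement.
Variable M : nat.
Local Open Scope nat_scope.

(* Rows, row entries, columns and column entries are all numbered from 1. *)
Definition row_length (rho : nat) : nat := (rho.-1 %/ M.+1).+1.

Lemma row_lengthP rho b : 0 < rho -> 0 < b ->
  (row_length rho == b) = (b.-1 * M.+1 < rho <= b * M.+1).
Proof.
rewrite /row_length; case: rho => // r _; case: b => // b _.
rewrite eqSS /= ltnS; apply/eqP/andP => [<-|[h1 h2]].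
  by split; rewrite ?leq_divM // ltn_ceil.
by apply/eqP; rewrite eqn_leq leq_divRL // h1 andbT -ltnS ltn_divLR.
Qed.

Definition row_entry (rho i : nat) : nat :=
  \sum_(1 <= r < rho) row_length r + i.

Definition J (i : nat) : set nat :=
  [set j | exists rho, [/\ 0 < rho, i <= row_length rho & j = row_entry rho i]].

(* The rows of length at least [i] are those after row [(i - 1)(M + 1)], so the
   [k]-th element of [J i] lies in row [(i - 1)(M + 1) + k]; the next two
   lemmas say that this is the increasing enumeration of [J i]. *)
Definition jcol (i k : nat) : nat := row_entry (i.-1 * M.+1 + k) i.

Lemma jcol_increasing i k k' : 0 < k -> k < k' -> jcol i k < jcol i k'.
Proof.
move=> k0 kk'; rewrite /jcol /row_entry ltn_add2r.
set a := _ + k; set b := _ + k'.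
have ab : a < b by rewrite ltn_add2l.
have a0 : 0 < a by rewrite addn_gt0 k0 orbT.
rewrite (big_cat_nat a0 (ltnW ab)) /=.
by rewrite -addn1 leq_add2l big_ltn // addSn.
Qed.

Lemma jcol_range i : 0 < i -> jcol i @` [set k | 0 < k] = J i.
Proof.
move=> i0; apply/seteqP; split=> j /=.
  move=> [k k0 <-]; exists (i.-1 * M.+1 + k); split=> //.
    by rewrite addn_gt0 k0 orbT.
  rewrite /row_length -[i in i <= _](prednK i0) ltnS leq_divRL //.
  by case: k k0 => // k _; rewrite addnS leq_addr.
move=> [rho [rho0 hi ->]]; exists (rho - i.-1 * M.+1); last first.
  rewrite /jcol subnKC //; apply: leq_trans (leq_pred _).
  by move: hi; rewrite -[i in i <= _](prednK i0) ltnS leq_divRL.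
rewrite subn_gt0; move: hi; rewrite -[i in i <= _](prednK i0) ltnS leq_divRL //.
by case: rho rho0.
Qed.

(* The union of the first [M + 1] elements of columns 1, ..., n, in increasing
   order. *)
Definition Jbar (n : nat) : seq nat :=
  sort leq [seq jcol i k | i <- iota 1 n, k <- iota 1 M.+1].

End Arrangement.

Section Walk.
Variables (R : realType) (M : nat).
Variables (o : 'I_(2 ^ M.+1) -> R) (vs : 'I_(2 ^ M.+1) -> M.+1.-tuple bool).

(* [Rv i x] is the unique outcome [o s] such that [vs s] is the word read off
   [x] at the first [M + 1] positions of column [i].  Composing [O] with the
   number whose digits are those of [x] in column [i] would give the same value
   only up to a null set: that number may be 0, 1, or a dyadic rational written
   with eventually constant 1s. *)
Definition Rv (i : nat) (x : R) : R :=
  if [pick s | word M.+1 x (jcol M i) == vs s] is Some s then o s else 0.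

Definition Sn (n : nat) (x : R) : R := \sum_(1 <= i < n.+1) Rv i x.

Definition cdf_S (n : nat) (t : R) : \bar R :=
  lebesgue_measure [set x | unit_interval x /\ Sn n x <= t].

Definition quantile_S (n : nat) (x : R) : R :=
  inf [set t | (x%:E <= cdf_S n t)%E].

Definition card_cells (n : nat) : nat := (2 ^ (n * M.+1))%N.

Definition left_endpoint (n : nat) (l : 'I_(card_cells n)) : R :=
  l%:R / (card_cells n)%:R.
Definition right_endpoint (n : nat) (l : 'I_(card_cells n)) : R :=
  l.+1%:R / (card_cells n)%:R.

Definition D (n : nat) (l : 'I_(card_cells n)) : set R :=
  [set x | unit_interval x /\ left_endpoint l <= x < right_endpoint l].

(* The quantile is left-continuous, hence in general not constant on [D l]: at
   a left endpoint it is replaced by its constant value on the interior. *)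
Definition Sstar (n : nat) (x : R) : R :=
  if [pick l : 'I_(card_cells n) | x == left_endpoint l] is Some l
  then const_value 0 [set y | left_endpoint l < y < right_endpoint l]
         (quantile_S n)
  else quantile_S n x.

Definition evec (n : nat) (l : 'I_(card_cells n)) : seq bool :=
  nth [tuple of nseq (n * M.+1) false]
    (Order.enum {: (n * M.+1).-tuplelexi bool}) l.

(* The coordinate of [evec l] at position [j] of [Jbar M n]. *)
Definition E (n : nat) (l : 'I_(card_cells n)) : set R :=
  [set x | unit_interval x /\
    forall j, j \in Jbar M n -> eps x j = nth false (evec l) (index j (Jbar M n))].

Definition ISstar (n : nat) (l : 'I_(card_cells n)) : R :=
  const_value 0 (D l) (Sstar n).
Definition IS (n : nat) (l : 'I_(card_cells n)) : R :=
  const_value 0 (E l) (Sn n).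

Definition admissible (n : nat) (pi : {perm 'I_(card_cells n)}) : Prop :=
  forall l x y, D l x -> E (pi l) y -> Sstar n x = Sn n y.

(* Entries of an element of [K n] are at most [n], whence the finite type. *)
Definition K (n : nat) : {set {ffun 'I_(2 ^ M.+1) -> 'I_n.+1}} :=
  [set k : {ffun 'I_(2 ^ M.+1) -> 'I_n.+1} | (\sum_s k s)%N == n].

Definition multinomial (n : nat) (k : {ffun 'I_(2 ^ M.+1) -> 'I_n.+1}) : nat :=
  (n`! %/ \prod_s (k s)`!)%N.

Definition dot (n : nat) (k : {ffun 'I_(2 ^ M.+1) -> 'I_n.+1}) : R :=
  \sum_s (k s)%:R * o s.

Definition values (n : nat) : seq R :=
  sort <=%R (undup [seq dot k | k in K n]).
Definition T (n : nat) : nat := (size (values n)).-1.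
Definition v (n t : nat) : R := nth 0 (values n) t.

Definition Kbar (n t : nat) : {set {ffun 'I_(2 ^ M.+1) -> 'I_n.+1}} :=
  if (t <= T n)%N then [set k in K n | dot k < v n t] else K n.

Definition SMC (n t : nat) : nat := (\sum_(k in Kbar n t) multinomial k)%N.

(* [SMC n] is nondecreasing on [0, T n + 1], so nothing is truncated. *)
Definition gamma (n t : nat) : nat := (SMC n t.+1 - SMC n t)%N.

Definition Step (n : nat) (x : R) : nat :=
  xget 0%N [set t | (t <= T n)%N /\ Sstar n x = v n t].
Definition Weight (n : nat) (x : R) : nat :=
  xget 0%N [set t | (t <= T n)%N /\ Sn n x = v n t].

Definition IStep (n : nat) (l : 'I_(card_cells n)) : nat :=
  const_value 0%N (D l) (Step n).
Definition IWeight (n : nat) (l : 'I_(card_cells n)) : nat :=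
  const_value 0%N (E l) (Weight n).

Definition A (n t : nat) : set R := [set x | unit_interval x /\ Step n x = t].
Definition B (n t : nat) : set R := [set x | unit_interval x /\ Weight n x = t].

Definition IA (n t : nat) : {set 'I_(card_cells n)} :=
  [set l : 'I_(card_cells n) | `[< D l `<=` A n t >]].
Definition IB (n t : nat) : {set 'I_(card_cells n)} :=
  [set l : 'I_(card_cells n) | `[< E l `<=` B n t >]].

Definition alpha (n t : nat) : nat := #|IA n t|.
Definition beta (n t : nat) : nat := #|IB n t|.

End Walk.

(* Main.v *)
Require Import Defs.
From HB Require Import structures.
From mathcomp Require Import all_boot all_order all_algebra perm.
From mathcomp Require Import all_classical all_reals all_analysis.

(** Both the quantile and the sum are, up to the bookkeeping of cells, finite
    objects.  The digits of a uniform point at distinct positions are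
    independent fair bits ([lebesgue_measure_digits]), so each cell [E l] has
    measure [1 / card_cells M n] and the distribution function of the sum at [t]
    is the fraction of the cells [E l] on which the sum is at most [t]
    ([cdf_S_count]).  Inverting this step function, the quantile takes on [D l]
    the [l]-th smallest, counting from 0, of the [card_cells M n] values of the
    sum, listed with multiplicity ([Sstar_cell]).  Hence [l |-> ISstar l] is a sorted
    rearrangement of [l |-> IS l]: every value is taken equally often by both.

    The cells [E l] are in bijection with the words of [n] outcomes
    ([outcomes_bij]); this uses that the positions in [Jbar M n] are distinct
    and that [vs] is a bijection ([words_of_outcomes_bij]).  The value of the
    sum on a cell depends only on how often each outcome occurs in the word, and
    a prescribed vector of multiplicities is realised by a multinomial
    coefficient of words ([card_tuple_counts]).  So the common number of cells
    on which the [t]-th value is taken is the difference [gamma o n t] of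
    consecutive sums of multinomial coefficients ([gamma_card]).

    Since cells are never empty, admissibility of [pi] says that the values
    [ISstar l] and [IS (pi l)] agree for all [l], and the other conditions
    express the same thing through the ranks of these values.  Finally, when
    [g] and [f] take every value [x] equally often, say [c x] times, the
    permutations [s] with [g (s i) = f i] number the product of the [c x]!
    ([card_perm_matching]); the fibres of [IS] over the values provide the
    factors [gamma o n t]!. *)

Set Implicit Arguments.
Unset Strict Implicit.
Unset Printing Implicit Defensive.

Import Order.TTheory GRing.Theory Num.Theory.
Import numFieldNormedType.Exports.
Local Open Scope ring_scope.

(** * Words with prescribed letter counts *)

Lemma card_set_count (X : finType) (P : pred X) :
  #|[set x | P x]%SET| = count P (enum X).
Proof.
rewrite cardE -size_filter enumT /enum_mem; congr size.
by apply: eq_filter => x; rewrite !inE.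
Qed.

Section Rearrangements.
Local Open Scope nat_scope.
Variable X : finType.

(** Induction on the length: removing the first letter [x] of a word lowers
    [k x] by one, and [(k x)`! = k x * (k x).-1`!], so the words that start with
    [x] contribute [k x * n`!]; these add up to [n.+1 * n`!]. *)
Lemma card_tuple_counts (n : nat) (k : X -> nat) :
  \sum_x k x = n ->
  #|[set u : n.-tuple X | [forall x, count_mem x u == k x]]|
    * \prod_x (k x)`! = n`!.
Proof.
elim: n k => [|n IHn] k sum_k.
  have k0 x : k x = 0.
    by apply/eqP; move: sum_k => /eqP; rewrite sum_nat_eq0 => /forallP /(_ x).
  rewrite big1 => [|x _]; last by rewrite k0.
  rewrite muln1 (_ : [set u | _] = [set [tuple]]) ?cards1 //.
  apply/setP => u; rewrite !inE [u]tuple0 eqxx.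
  by apply/forallP => x; rewrite k0.
rewrite -sum1dep_card.
pose cons2 (p : X * n.-tuple X) := [tuple of p.1 :: p.2].
rewrite (reindex cons2); last first.
  exists (fun u => (thead u, [tuple of behead u])) => [[x u]|u] _ /=.
    by rewrite /thead tnth0; congr pair; apply: val_inj.
  by case/tupleP: u => x u; rewrite /cons2 /thead tnth0; apply: val_inj.
rewrite -(pair_big_dep xpredT
  (fun x (u : n.-tuple X) => [forall y, (x == y) + count_mem y u == k y])
  (fun _ _ => 1)) /=.
under eq_bigr => x _ do rewrite sum1dep_card.
rewrite big_distrl /=.
rewrite factS -sum_k big_distrl /=; apply: eq_bigr => x _.
have [kx0|kx_gt0] := posnP (k x).
  rewrite kx0 mul0n (_ : [set u | _] = finset.set0) ?cards0 //.
  apply/setP => u; rewrite !inE; apply/negP => /forallP /(_ x).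
  by rewrite eqxx kx0.
pose k' y := k y - (x == y).
have sum_k' : \sum_y k' y = n.
  have: \sum_y (k' y + (x == y)) = n.+1.
    rewrite -sum_k; apply: eq_bigr => y _; rewrite subnK //.
    by case: eqP => [<-|//].
  rewrite big_split /= [X in _ + X](bigD1 x) //= eqxx [X in _ + (_ + X)]big1; last first.
    by move=> y yx; rewrite eq_sym (negPf yx).
  by rewrite addn0 addn1 => -[].
rewrite -(IHn k' sum_k') mulnCA; congr (_ * _).
  apply: eq_card => u; rewrite !inE; apply: eq_forallb => y; rewrite /k'.
  case: (x =P y) => [<-|_] /=; last by rewrite subn0.
  by rewrite -{1}(subnK kx_gt0) addnC eqn_add2r.
rewrite (bigD1 x) //= [in RHS](bigD1 x) //= mulnA; congr (_ * _).
  by rewrite /k' eqxx subn1 -{1}(prednK kx_gt0) factS prednK.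
apply: eq_bigr => y yx; congr (_`!).
by rewrite /k' eq_sym (negPf yx) /= subn0.
Qed.

Lemma count_mktuple (n : nat) (f : 'I_n -> X) (x : X) :
  count_mem x [tuple f i | i < n] = #|[set i | f i == x]|.
Proof. by rewrite card_set_count /= count_map. Qed.

(** Orbit counting: the symmetric group permutes the words whose letter counts
    are those of [g].  All these words are hit by equally many permutations,
    because the permutations carrying [g] to [f] form a coset of the stabiliser
    of [g]; so [N`!] is that number times a multinomial coefficient. *)
Lemma card_perm_matching (N : nat) (g f : 'I_N -> X) :
    (forall x, #|[set i | f i == x]| = #|[set i | g i == x]|) ->
  #|[set s : 'S_N | [forall i, g (s i) == f i]]|
    = \prod_x (#|[set i | g i == x]|)`!.
Proof.
move=> card_fg.
pose F (f : N.-tuple X) := [set s : 'S_N | [tuple g (s i) | i < N] == f].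
have counts s x : count_mem x [tuple g (fun_of_perm s i) | i < N]
    = #|[set i | g i == x]|.
  rewrite count_mktuple -(card_imset _ (@perm_inj _ s)); apply: eq_card => i.
  apply/imsetP/idP => [[j]|]; rewrite inE; first by rewrite inE => ? ->.
  by move=> gi; exists (s^-1%g i); rewrite ?inE permKV.
pose good := [set f : N.-tuple X |
  [forall x, count_mem x f == #|[set i | g i == x]|]].
have cardF f1 : f1 \in good -> #|F f1| = #|F [tuple g i | i < N]|.
  rewrite inE => /forallP f1P.
  have : perm_eq f1 [tuple g i | i < N].
    apply/allP => x _ /=; rewrite (eqP (f1P x)); apply/eqP.
    by rewrite -count_mktuple.
  case/tuple_permP => s0 f1E.
  rewrite -[RHS](card_imset _ (mulgI s0)); apply: eq_card => s.
  have f1i i : tnth f1 i = g (s0 i).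
    rewrite (_ : f1 = [tuple tnth [tuple g i | i < N] (s0 i) | i < N]).
      by rewrite !tnth_mktuple.
    exact: val_inj.
  rewrite [LHS]inE; apply/eqP/imsetP => [sf|[t]].
    exists (s0^-1 * s)%g; last by rewrite mulgA mulgV mul1g.
    rewrite inE; apply/eqP/eq_from_tnth => i.
    rewrite !tnth_mktuple permM.
    have := congr1 (fun f => tnth f (s0^-1%g i)) sf.
    by rewrite tnth_mktuple f1i permKV.
  rewrite inE => /eqP tg ->; apply/eq_from_tnth => i.
  rewrite !tnth_mktuple permM f1i.
  by have := congr1 (fun f => tnth f (s0 i)) tg; rewrite !tnth_mktuple.
have Fg : [set s : 'S_N | [forall i, g (s i) == f i]] = F [tuple f i | i < N].
  apply/setP => s; rewrite !inE; apply/forallP/eqP => [gf|sf i].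
    by apply/eq_from_tnth => i; rewrite !tnth_mktuple; apply/eqP.
  by have := congr1 (fun f => tnth f i) sf; rewrite !tnth_mktuple => ->.
rewrite Fg cardF; last first.
  by rewrite inE; apply/forallP => x; rewrite count_mktuple card_fg.
(* Sorting all permutations by the word they produce. *)
have : N`! = #|good| * #|F [tuple g i | i < N]|.
  rewrite -card_Sn -[LHS]sum1_card.
  rewrite (partition_big (fun s : 'S_N => [tuple g (s i) | i < N])
    (mem good)) /=; last first.
    by move=> s _; rewrite inE; apply/forallP => x; rewrite counts.
  rewrite -sum_nat_const; apply: eq_bigr => f1 f1_good.
  rewrite -(cardF f1 f1_good) -sum1_card; apply: eq_bigl => s.
  by rewrite !inE.
rewrite -(@card_tuple_counts N (fun x => #|[set i | g i == x]|)); last first.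
  rewrite -[RHS](card_ord N) -[RHS]sum1_card.
  rewrite (partition_big g xpredT) //=; apply: eq_bigr => x _.
  by rewrite -sum1dep_card.
move/eqP; rewrite eqn_pmul2l => [/eqP -> //|].
apply/card_gt0P; exists [tuple g i | i < N].
by rewrite inE; apply/forallP => x; rewrite count_mktuple.
Qed.

End Rearrangements.

(** * Binary digits of a point *)

Section Digits.
Variable R : realType.
Implicit Types (x : R) (e : nat -> bool).

Let digit_sum e k : R := \sum_(1 <= i < k.+1) (e i)%:R * 2 ^- i.

(** The integer whose binary notation is [e 1 ... e k]. *)
Fixpoint prefix_code e (k : nat) : nat :=
  if k is k'.+1 then ((prefix_code e k').*2 + e k)%N else 0%N.

Lemma digit_sum_code e k : digit_sum e k = (prefix_code e k)%:R / 2 ^+ k.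
Proof.
elim: k => [|k IHk]; first by rewrite /digit_sum big_geq //= mul0r.
rewrite /digit_sum big_nat_recr //= -/(digit_sum e k) IHk natrD mulrDl; congr +%R.
by rewrite -muln2 natrM exprSr invfM mulrACA divff ?mulr1.
Qed.

(** The partial sums increase to [x], while the partial sums enlarged by the
    weight of their last digit decrease, strictly so at every digit 0; since
    such digits occur beyond every [k], the upper bound is strict.  This is
    where expansions with eventually constant 1s are excluded. *)
Lemma binary_expansion_code x e k : binary_expansion x e ->
  (prefix_code e k)%:R <= x * 2 ^+ k < (prefix_code e k).+1%:R.
Proof.
move=> [cvg_e zero_e].
have pow_gt0 i : 0 < (2 : R) ^+ i by exact: exprn_gt0.
have sum_mono : {homo digit_sum e : i j / (i <= j)%N >-> i <= j}.
  apply: homo_leq => // [y x' z|i]; first exact: le_trans.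
  rewrite {2}/digit_sum big_nat_recr //= lerDl mulr_ge0 ?ler0n//.
pose upper i := digit_sum e i + 2 ^- i.
have half i : 2 ^- i = 2 ^- i.+1 + 2 ^- i.+1 :> R.
  by rewrite exprSr invfM -splitr.
have upper_mono : {homo upper : i j / (i <= j)%N >-> j <= i}.
  apply: homo_leq => // [y x' z yx xz|i]; first exact: le_trans xz yx.
  rewrite /upper {1}/digit_sum big_nat_recr //= -/(digit_sum e i) -addrA lerD2l (half i).
  by rewrite lerD2r ler_piMl ?invr_ge0 ?(ltW (pow_gt0 _))// lern1 leq_b1.
apply/andP; split.
  rewrite -ler_pdivrMr // -digit_sum_code.
  by apply: cvgr_to_ge cvg_e _; exists k => // i /sum_mono.
have [[//|i] ki ei] := zero_e k.+1.
rewrite -ltr_pdivlMr // -addn1 natrD mulrDl mul1r -digit_sum_code -/(upper k).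
apply: le_lt_trans (_ : upper i.+1 < _).
  apply: cvgr_to_le cvg_e _; exists i.+1 => // j /= ij.
  apply: le_trans (upper_mono _ _ ij).
  by rewrite lerDl invr_ge0 ltW.
apply: lt_le_trans (upper_mono k i ki).
rewrite /upper {1}/digit_sum big_nat_recr //= ei mul0r addr0 ltrD2l (half i).
by rewrite ltrDl invr_gt0.
Qed.

Lemma binary_expansion_digit x e i : binary_expansion x e -> (0 < i)%N ->
  e i = odd (Num.truncn (x * 2 ^+ i)).
Proof.
move=> /(binary_expansion_code i)/truncn_def ->.
by case: i => //= i _; rewrite oddD odd_double oddb.
Qed.

Lemma truncn_double x : 0 <= x ->
  Num.truncn (x * 2) = ((Num.truncn x).*2 + odd (Num.truncn (x * 2)))%N.
Proof.
move=> x0; rewrite -[LHS]odd_double_half addnC; congr (_.*2 + _)%N.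
have /andP[lo hi] := truncn_itv (mulr_ge0 x0 (ler0n R 2)).
symmetry; apply: truncn_def; apply/andP; split.
  rewrite -(ler_pM2r (ltr0n R 2)) -natrM; apply: le_trans lo.
  by rewrite ler_nat muln2 -{2}[Num.truncn _]odd_double_half leq_addl.
rewrite -(ltr_pM2r (ltr0n R 2)) -natrM; apply: lt_le_trans hi _.
rewrite ler_nat muln2 doubleS ltnS -{1}[Num.truncn _]odd_double_half.
by rewrite -[leqRHS]add1n leq_add2r leq_b1.
Qed.

Definition dyadic_digit x (i : nat) : bool := odd (Num.truncn (x * 2 ^+ i)).

Lemma prefix_code_dyadic x k : 0 <= x < 1 ->
  prefix_code (dyadic_digit x) k = Num.truncn (x * 2 ^+ k).
Proof.
move=> /andP[x0 x1]; elim: k => [|k IHk] /=.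
  by rewrite expr0 mulr1; symmetry; apply: truncn_def; rewrite x0.
have xk0 : 0 <= x * 2 ^+ k by rewrite mulr_ge0 ?exprn_ge0.
by rewrite IHk /dyadic_digit exprSr mulrA -truncn_double.
Qed.

(** The floor of [x * 2 ^+ k] is the integer written by the first [k] digits, so
    the partial sums are within [2 ^- k] of [x].  If the digits were all 1 from
    [N] on, then [x * 2 ^+ N] would be arbitrarily close to the integer just
    above its own floor. *)
Lemma dyadic_expansion x : 0 <= x < 1 -> binary_expansion x (dyadic_digit x).
Proof.
move=> x01; have /andP[x0 x1] := x01.
have pow_gt0 i : 0 < (2 : R) ^+ i by exact: exprn_gt0.
have xk0 k : 0 <= x * 2 ^+ k by rewrite mulr_ge0 // ltW.
split.
  apply: (@squeeze_cvgr _ _ _ _ (fun k => x - 2^-1 ^+ k) (fun=> x)).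
  - apply: nearW => k; rewrite -/(digit_sum _ k) digit_sum_code prefix_code_dyadic //.
    have /andP[lo hi] := truncn_itv (xk0 k).
    rewrite ler_pdivrMr // lo andbT ler_pdivlMr // mulrBl exprVn mulVf ?gt_eqF//.
    by rewrite lerBlDr natr1 ltW.
  - rewrite -[X in (_ --> X)%classic]subr0; apply: cvgB; first exact: cvg_cst.
    by apply: cvg_expr; rewrite gtr0_norm ?invr_gt0// invf_lt1 ?ltr1n.
  - exact: cvg_cst.
move=> N; apply: contrapT => nozero.
have one i : (N <= i)%N -> dyadic_digit x i.
  by move=> Ni; apply/negPn/negP => /negbTE xi; apply: nozero; exists i.
have tail d : ((Num.truncn (x * 2 ^+ (N + d))).+1
    = (Num.truncn (x * 2 ^+ N)).+1 * 2 ^ d)%N.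
  elim: d => [|d IHd]; first by rewrite addn0 muln1.
  rewrite addnS -prefix_code_dyadic //= prefix_code_dyadic // one ?leqW ?leq_addr//.
  by rewrite addn1 -doubleS IHd -muln2 expnSr mulnA.
pose gap := (Num.truncn (x * 2 ^+ N)).+1%:R - x * 2 ^+ N.
have gap0 : 0 < gap by rewrite subr_gt0 truncnS_gt.
have gap_le d : gap * d%:R < 1.
  apply: (@lt_le_trans _ _ (gap * 2 ^+ d)).
    by rewrite ltr_pM2l // -natrX ltr_nat ltn_expl.
  rewrite mulrBl -mulrA -exprD -[2 ^+ d]natrX -natrM -tail.
  rewrite -natr1 lerBlDr addrC lerD2l.
  by have /andP[] := truncn_itv (xk0 (N + d)%N).
have := gap_le (Num.truncn gap^-1).+1.
rewrite mulrC -ltr_pdivlMr // mul1r => /(lt_trans (truncnS_gt _)).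
by rewrite ltxx.
Qed.

(** By uniqueness of the expansion, whichever sequence [eps] picks has these
    digits; the restriction to positive positions is essential, as position 0
    carries no weight in the sum. *)
Lemma epsE x i : unit_interval x -> (0 < i)%N ->
  eps x i = odd (Num.truncn (x * 2 ^+ i)).
Proof.
move=> /andP[x0 x1] i0; apply: binary_expansion_digit => //.
rewrite /eps; case: xgetP => [e -> //|/(_ (dyadic_digit x))[]].
by apply: dyadic_expansion; rewrite ltW.
Qed.

Lemma truncn_shift x k d : 0 <= x < 1 ->
  Num.truncn (x * 2 ^+ k) = (Num.truncn (x * 2 ^+ (k + d)) %/ 2 ^ d)%N.
Proof.
move=> x01; elim: d => [|d IHd]; first by rewrite addn0 divn1.
rewrite IHd addnS -!prefix_code_dyadic //= expnS divnMA; congr (_ %/ _)%N.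
by rewrite divn2 [in RHS]addnC half_bit_double.
Qed.

End Digits.

(** * Distribution of finitely many digits *)

Section Words.
Local Open Scope nat_scope.

Definition code_bits (L w : nat) : {ffun 'I_L -> bool} :=
  [ffun i : 'I_L => odd (w %/ 2 ^ (L - i.+1))].

Lemma code_bits_bij L : bijective (fun w : 'I_(2 ^ L) => code_bits L w).
Proof.
apply: inj_card_bij; last by rewrite card_ffun card_bool !card_ord.
move=> w w' bits; apply: val_inj.
suff prefix k : k <= L -> w %/ 2 ^ (L - k) = w' %/ 2 ^ (L - k).
  by have := prefix L (leqnn _); rewrite subnn !divn1.
elim: k => [|k IHk] kL; first by rewrite subn0 !divn_small.
have halve (v : nat) : v %/ 2 ^ (L - k) = (v %/ 2 ^ (L - k.+1))./2.
  by rewrite -divn2 -divnMA -expnSr subnSK.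
rewrite -[LHS]odd_double_half -[RHS]odd_double_half -!halve IHk ?(ltnW kL)//.
by have /ffunP/(_ (Ordinal kL)) := bits; rewrite !ffunE => ->.
Qed.

(** [F] lists the bits allowed at each of the [L] places: one at the [p] places
    in the image of [q], two at the others. *)
Lemma card_prescribed_bits p L (q : 'I_p -> 'I_L) (u : p.-tuple bool) :
  injective q ->
  #|[set b : {ffun 'I_L -> bool} | [tuple b (q r) | r < p] == u]| = 2 ^ (L - p).
Proof.
move=> q_inj.
pose F i : pred bool := if [pick r | q r == i] is Some r then pred1 (tnth u r)
  else predT.
have Fq r : F (q r) = pred1 (tnth u r).
  rewrite /F; case: pickP => [s /eqP/q_inj -> //|/(_ r)].
  by rewrite eqxx.
rewrite (_ : #|_| = #|family F|); last first.
  apply: eq_card => b; rewrite inE; apply/eqP/familyP => [bu i|bF].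
    rewrite /F; case: pickP => [r /eqP <-|//].
    by rewrite inE -bu tnth_mktuple.
  apply/eq_from_tnth => r; rewrite tnth_mktuple.
  by have := bF (q r); rewrite Fq inE => /eqP.
rewrite card_family foldrE big_map big_enum /=.
rewrite (bigID (mem (q @: [set: 'I_p]%SET))) /= big1 ?mul1n; last first.
  by move=> i /imsetP[r _ ->]; rewrite Fq card1.
rewrite (eq_bigr (fun=> 2)); last first.
  move=> i /imsetP iq; rewrite /F; case: pickP => [r /eqP qr|_].
    by case: iq; exists r; rewrite ?inE.
  by rewrite cardT enumT unlock.
rewrite prod_nat_const; congr (_ ^ _).
have /(congr1 (subn^~ p)) := cardsC (q @: [set: 'I_p]%SET).
rewrite card_imset // cardsT !card_ord addKn => <-.
by apply: eq_card => i; rewrite !inE.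
Qed.

Lemma card_codes_prescribed p L (q : 'I_p -> 'I_L) (Q : pred (p.-tuple bool)) :
  injective q ->
  #|[set w : 'I_(2 ^ L) | Q [tuple code_bits L w (q r) | r < p]]|
    = #|[set u | Q u]| * 2 ^ (L - p).
Proof.
move=> q_inj; have [dec bitsK decK] := code_bits_bij L.
rewrite -[LHS]sum1dep_card (reindex dec) /=; last first.
  by exists (fun w : 'I__ => code_bits L w) => ? _; [exact: decK|exact: bitsK].
under eq_bigl => b do rewrite decK.
rewrite (partition_big (fun b : {ffun 'I_L -> bool} => [tuple b (q r) | r < p])
  (mem [set u | Q u])) /=; last by move=> b; rewrite inE.
rewrite -sum_nat_const; apply: eq_bigr => u; rewrite inE => Qu.
rewrite -(card_prescribed_bits u q_inj) -sum1dep_card; apply: eq_bigl => b.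
by case: eqP => [->|]; rewrite ?Qu ?andbF.
Qed.

End Words.

Section Measure.
Variable R : realType.
Local Open Scope classical_set_scope.

(** The cell is the interval from [w / 2 ^+ L] to [w.+1 / 2 ^+ L], closed on the
    left except for [w = 0], where the point 0 does not belong to (0, 1). *)
Lemma lebesgue_measure_dyadic_cell L (w : 'I_(2 ^ L)) :
  let cell := [set x : R | unit_interval x /\ Num.truncn (x * 2 ^+ L) = w] in
  measurable cell /\ lebesgue_measure cell = (2 ^- L)%:E.
Proof.
have L0 : 0 < 2 ^+ L :> R by exact: exprn_gt0.
set cell := [set x | _].
pose I := Interval (BSide (val w != 0%N) (w%:R / 2 ^+ L : R))
                   (BLeft (w.+1%:R / 2 ^+ L)).
have -> : cell = [set` I].
  apply/seteqP; split => x /=.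
    move=> [/andP[x0 x1] xw].
    have /truncn_itv/andP[] : 0 <= x * 2 ^+ L by rewrite mulr_ge0 ?ltW.
    rewrite xw in_itv /= => lo hi; rewrite ltr_pdivlMr // hi andbT.
    by case: eqP => [->|_] /=; rewrite ?mul0r // ler_pdivrMr.
  rewrite in_itv /= => /andP[lo]; rewrite ltr_pdivlMr // => hi.
  have lo' : w%:R <= x * 2 ^+ L.
    by rewrite -ler_pdivrMr // (lteifW lo).
  have x0 : 0 < x.
    move: lo; case: eqP => [->|/eqP w0] /=; first by rewrite mul0r.
    by apply: lt_le_trans; rewrite divr_gt0 // ltr0n lt0n.
  split; last by apply: truncn_def; rewrite lo' hi.
  rewrite /unit_interval /= x0 /= -(ltr_pM2r L0) mul1r (lt_le_trans hi) //.
  by rewrite -natrX ler_nat.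
split; first exact: measurable_itv.
rewrite lebesgue_measure_itv /= lte_fin ltr_pM2r ?invr_gt0 // ltr_nat ltnSn.
by rewrite -EFinD -mulrBl -natrB // subSnn mul1r.
Qed.

Lemma lebesgue_measure_dyadic L (P : pred nat) :
  lebesgue_measure [set x : R | unit_interval x /\ P (Num.truncn (x * 2 ^+ L))]
  = (#|[set w : 'I_(2 ^ L) | P w]%SET|%:R / 2 ^+ L)%:E.
Proof.
have L0 : 0 < 2 ^+ L :> R by exact: exprn_gt0.
pose cell (w : 'I_(2 ^ L)) :=
  [set x : R | unit_interval x /\ Num.truncn (x * 2 ^+ L) = w].
rewrite (_ : [set x | _] = \big[setU/set0]_(w < 2 ^ L | P w) cell w).
  rewrite measure_bigsetU_ord_cond; last 2 first.
    by move=> w _; have [] := lebesgue_measure_dyadic_cell w.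
    by move=> w w' _ _ [x [[_ xw] [_ xw']]]; apply: val_inj; rewrite /= -xw.
  rewrite (eq_bigr (fun=> (2 ^- L)%:E)); last first.
    by move=> w _; exact: (lebesgue_measure_dyadic_cell w).2.
  by rewrite sumEFin sumr_const mulr_natl cardsE.
rewrite -bigcup_seq_cond; apply/seteqP; split=> x /=.
  move=> [x01 Px]; have /andP[x0 x1] := x01.
  have xL : (Num.truncn (x * 2 ^+ L) < 2 ^ L)%N.
    by rewrite truncn_lt_nat ?mulr_ge0 1?ltW // natrX gtr_pMl.
  by exists (Ordinal xL); rewrite //= mem_index_enum.
by move=> [w /= /andP[_ Pw] [x01 xw]]; rewrite xw.
Qed.

(** The digits of a uniform point at distinct positions are independent and
    fair.  With [L] the largest position involved, the event is a union of
    dyadic intervals of length [2 ^- L], namely [2 ^ (L - p)] of them for each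
    word of [Q]. *)
Lemma lebesgue_measure_digits p (j : 'I_p -> nat) (Q : pred (p.-tuple bool)) :
  injective j -> (forall r, 0 < j r)%N ->
  lebesgue_measure [set x : R | unit_interval x /\ Q [tuple eps x (j r) | r < p]]
  = (#|[set u | Q u]%SET|%:R / 2 ^+ p)%:E.
Proof.
move=> j_inj j0.
pose L := (\max_r j r)%N.
have jL r : ((j r).-1 < L)%N by rewrite prednK // leq_bigmax.
pose q r := Ordinal (jL r).
have q_inj : injective q.
  move=> r r' /(congr1 val) /= jr; apply: j_inj.
  by rewrite -(prednK (j0 r)) jr prednK.
have pL : (p <= L)%N by have := leq_card _ q_inj; rewrite !card_ord.
rewrite (_ : [set x | _] = [set x : R | unit_interval x /\
    Q [tuple code_bits L (Num.truncn (x * 2 ^+ L)) (q r) | r < p]]).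
  rewrite (lebesgue_measure_dyadic L (fun w => Q [tuple code_bits L w (q r) | r < p])).
  rewrite card_codes_prescribed // natrM natrX -[in 2 ^+ L](subnK pL) exprD.
  rewrite [X in _ / X]mulrC invfM mulrACA divff ?mulr1 //.
have digits x : unit_interval x -> [tuple eps x (j r) | r < p]
    = [tuple code_bits L (Num.truncn (x * 2 ^+ L)) (q r) | r < p].
  move=> x01; apply/eq_from_tnth => r.
  rewrite !tnth_mktuple ffunE /= epsE // (truncn_shift _ (L - j r)).
    by rewrite prednK // subnKC // leq_bigmax.
  by have /andP[/ltW -> ->] := x01.
by apply/seteqP; split=> x /= [x01]; [rewrite digits|rewrite -digits].
Qed.

(** A prescribed block of digits occurs because it does so with probability
    [2 ^- p], which is positive. *)
Lemma digits_surj p (j : 'I_p -> nat) : injective j -> (forall r, 0 < j r)%N ->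
  forall w : p.-tuple bool,
  exists2 x : R, unit_interval x & [tuple eps x (j r) | r < p] = w.
Proof.
move=> j_inj j0 w; apply: contrapT => no_x.
have := lebesgue_measure_digits (pred1 w) j_inj j0.
rewrite (_ : [set x | _] = set0); last first.
  by apply/seteqP; split=> x //= [x01 /eqP xw]; apply: no_x; exists x.
rewrite measure0 => -[] /esym/eqP.
rewrite mulf_eq0 invr_eq0 expf_eq0 !pnatr_eq0 andbF orbF cards_eq0.
by move=> /eqP/setP/(_ w); rewrite !inE eqxx.
Qed.

End Measure.

(** * Positions of the digits in the arrangement *)

Section Positions.
Variable M : nat.
Local Open Scope nat_scope.

Lemma row_entry_lt rho rho' i i' : rho < rho' -> 0 < rho ->
  i <= row_length M rho -> 0 < i' -> row_entry M rho i < row_entry M rho' i'.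
Proof.
move=> lt_rho rho0 le_i i'0; rewrite /row_entry (big_cat_nat rho0 (ltnW lt_rho)) /=.
rewrite -addnA -addnS leq_add2l big_ltn // -addnA.
by apply: leq_trans (leq_add le_i (leq_trans i'0 (leq_addl _ i'))); rewrite addn1.
Qed.

(** Entries of different rows are different since the rows follow one another,
    and the row of [jcol M i k] together with its place [i] in it gives [k]. *)
Lemma jcol_inj i i' k k' : 0 < i -> 0 < i' -> 0 < k <= M.+1 -> 0 < k' <= M.+1 ->
  jcol M i k = jcol M i' k' -> (i, k) = (i', k').
Proof.
have row_long a b : 0 < a -> 0 < b ->
    [/\ 0 < a.-1 * M.+1 + b & a <= row_length M (a.-1 * M.+1 + b)].
  move=> a0 b0; split; first by rewrite addn_gt0 b0 orbT.
  rewrite /row_length -[a in a <= _](prednK a0) ltnS leq_divRL //.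
  by case: b b0 => // b _; rewrite addnS leq_addr.
move=> i0 i'0 /andP[k0 kM] /andP[k'0 k'M]; rewrite /jcol.
have [r0 ri] := row_long _ _ i0 k0; have [r'0 ri'] := row_long _ _ i'0 k'0.
set r := _ + k in r0 ri *; set r' := _ + k' in r'0 ri' * => eq_entry.
have [rr'|r'r|rE] := ltngtP r r'.
- by have := row_entry_lt rr' r0 ri i'0; rewrite eq_entry ltnn.
- by have := row_entry_lt r'r r'0 ri' i0; rewrite eq_entry ltnn.
move: eq_entry; rewrite rE => /addnI iE.
by move: rE; rewrite /r /r' iE => /addnI ->.
Qed.

Lemma Jbar_uniq n : uniq (Jbar M n).
Proof.
rewrite sort_uniq allpairs_uniq ?iota_uniq // => -[i k] [i' k'].
move=> /allpairsP[[a b] [+ + [-> ->]]] /allpairsP[[a' b'] [+ + [-> ->]]] /=.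
rewrite !mem_iota !add1n !ltnS => /andP[a0 _] b1 /andP[a'0 _] b'1.
exact: jcol_inj.
Qed.

Lemma size_Jbar n : size (Jbar M n) = n * M.+1.
Proof. by rewrite size_sort size_allpairs !size_iota. Qed.

Lemma mem_Jbar n j : reflect
  (exists i k, [/\ 0 < i <= n, 0 < k <= M.+1 & j = jcol M i k]) (j \in Jbar M n).
Proof.
rewrite mem_sort; apply: (iffP allpairsP) => [[[i k] []]|[i [k [i1 k1 ->]]]].
  by rewrite !mem_iota !add1n !ltnS => i1 k1 jE; exists i, k.
by exists (i, k); rewrite !mem_iota !add1n !ltnS.
Qed.

Lemma jcol_gt0 i k : 0 < i -> 0 < jcol M i k.
Proof. by move=> i0; rewrite addn_gt0 i0 orbT. Qed.

Lemma Jbar_gt0 n j : j \in Jbar M n -> 0 < j.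
Proof. by move=> /mem_Jbar[i [k [/andP[i0 _] _ ->]]]; exact: jcol_gt0. Qed.

End Positions.

(** * The sum of the outcomes on the cells *)

Lemma const_valueE (A : Type) (B : choiceType) (b0 b : B) (D : set A) (f : A -> B) :
  (exists x, D x) -> (forall x, D x -> f x = b) -> const_value b0 D f = b.
Proof.
move=> [x Dx] fb; rewrite /const_value; case: xgetP => [b' _ /(_ x Dx) <-|].
  exact: fb.
by move=> /(_ b)[].
Qed.

Section Cells.
Variables (R : realType) (M : nat).
Variables (o : 'I_(2 ^ M.+1) -> R) (vs : 'I_(2 ^ M.+1) -> M.+1.-tuple bool).
Hypothesis vs_bij : bijective vs.
Variable n : nat.
Local Notation p := (n * M.+1)%N.

(** [evec l] with its length in its type, so that the enumeration becomes a
    bijection between finite types. *)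
Definition cell_word (l : 'I_(card_cells M n)) : p.-tuple bool :=
  nth [tuple of nseq p false] (Order.enum {: p.-tuplelexi bool}) l.

Lemma cell_word_bij : bijective cell_word.
Proof.
apply: inj_card_bij; last by rewrite card_tuple card_bool card_ord.
have size_enum : size (Order.enum {: p.-tuplelexi bool}) = card_cells M n.
  by rewrite size_sort -cardE card_tuple card_bool.
move=> l l' /eqP; rewrite /cell_word nth_uniq ?size_enum // => [/eqP/val_inj //|].
by rewrite sort_uniq enum_uniq.
Qed.

Definition Jbar_word (x : R) : p.-tuple bool :=
  [tuple eps x (nth 0%N (Jbar M n) r) | r < p].

Lemma E_Jbar_word l x :
  E l x <-> unit_interval x /\ Jbar_word x = cell_word l.
Proof.
split=> -[x01 xl]; split=> //.
  apply/eq_from_tnth => r; have rJ : (r < size (Jbar M n))%N by rewrite size_Jbar.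
  rewrite tnth_mktuple xl ?mem_nth // index_uniq ?Jbar_uniq //.
  by rewrite (tnth_nth false).
move=> j jJ; have jp : (index j (Jbar M n) < p)%N by rewrite -size_Jbar index_mem.
by rewrite /evec -/(cell_word l) -xl (nth_mktuple _ _ (Ordinal jp)) nth_index.
Qed.

Lemma Jbar_nth_inj : injective (fun r : 'I_p => nth 0%N (Jbar M n) r).
Proof.
by move=> r r' /eqP; rewrite nth_uniq ?size_Jbar ?Jbar_uniq // => /eqP/val_inj.
Qed.

Lemma Jbar_nth_gt0 (r : 'I_p) : (0 < nth 0 (Jbar M n) r)%N.
Proof. by apply: (@Jbar_gt0 M n); rewrite mem_nth ?size_Jbar. Qed.

Definition column_word (u : p.-tuple bool) (i : nat) : M.+1.-tuple bool :=
  [tuple nth false u (index (jcol M i k.+1) (Jbar M n)) | k < M.+1].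

(** The digits that decide the [i]-th outcome all have their positions in
    [Jbar M n]. *)
Lemma word_column x i : (0 < i <= n)%N ->
  word M.+1 x (jcol M i) = column_word (Jbar_word x) i.
Proof.
move=> i1n; apply/eq_from_tnth => k; rewrite !tnth_mktuple.
have jJ : jcol M i k.+1 \in Jbar M n by apply/mem_Jbar; exists i, k.+1; rewrite ltn_ord.
have jp : (index (jcol M i k.+1) (Jbar M n) < p)%N by rewrite -size_Jbar index_mem.
by rewrite (nth_mktuple _ _ (Ordinal jp)) nth_index.
Qed.

Lemma num_outcomes_gt0 : (0 < 2 ^ M.+1)%N.
Proof. by rewrite expn_gt0. Qed.

Definition outcome_of_word (w : M.+1.-tuple bool) : 'I_(2 ^ M.+1) :=
  odflt (Ordinal num_outcomes_gt0) [pick s | w == vs s].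

Lemma vsK : cancel vs outcome_of_word.
Proof.
move=> s; rewrite /outcome_of_word; case: pickP => [s' /eqP/(bij_inj vs_bij) ->//|].
by move=> /(_ s); rewrite eqxx.
Qed.

Lemma outcome_of_wordK : cancel outcome_of_word vs.
Proof. by case: vs_bij => g gK Kg w; rewrite -(Kg w) vsK. Qed.

Definition outcomes (l : 'I_(card_cells M n)) : n.-tuple 'I_(2 ^ M.+1) :=
  [tuple outcome_of_word (column_word (cell_word l) i.+1) | i < n].

(** Every place of a word over [Jbar M n] is read by one of the first [n]
    columns, so the [n] outcomes determine the word; the cardinalities agree
    because [2 ^ (n * M.+1) = (2 ^ M.+1) ^ n]. *)
Lemma outcomes_bij : bijective outcomes.
Proof.
apply: inj_card_bij; last first.
  by rewrite card_tuple !card_ord /card_cells mulnC expnM.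
move=> l l' eq_out; apply: (bij_inj cell_word_bij); apply/eq_from_tnth => r.
have /mem_Jbar[[|i] [[|k] [// i_n kM jE]]] : nth 0%N (Jbar M n) r \in Jbar M n.
  by rewrite mem_nth ?size_Jbar.
have := congr1 (fun u => tnth (vs (tnth u (Ordinal i_n))) (Ordinal kM)) eq_out.
rewrite !tnth_mktuple !outcome_of_wordK !tnth_mktuple /= -jE.
by rewrite index_uniq ?size_Jbar ?Jbar_uniq // -!tnth_nth.
Qed.

Definition outcome_sum (u : n.-tuple 'I_(2 ^ M.+1)) : R := \sum_(i < n) o (tnth u i).

Lemma Sn_cell l x : E l x -> Sn o vs n x = outcome_sum (outcomes l).
Proof.
move=> /E_Jbar_word[_ xl]; rewrite /Sn big_add1 /= big_mkord.
apply: eq_bigr => i _; rewrite tnth_mktuple /Rv word_column ?ltn_ord // xl.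
rewrite -{1}[column_word _ _]outcome_of_wordK.
case: pickP => [s /eqP/(bij_inj vs_bij) -> //|].
by move=> /(_ (outcome_of_word (column_word (cell_word l) i.+1))); rewrite eqxx.
Qed.

Lemma E_cover (x : R) :
  unit_interval x -> exists l : 'I_(card_cells M n), E l x.
Proof.
move=> x01; have [g gK Kg] := cell_word_bij.
by exists (g (Jbar_word x)); apply/E_Jbar_word; rewrite Kg.
Qed.

Lemma E_neq0 (l : 'I_(card_cells M n)) : exists x : R, E l x.
Proof.
have [x x01 xl] := digits_surj R Jbar_nth_inj Jbar_nth_gt0 (cell_word l).
by exists x; apply/E_Jbar_word.
Qed.

Lemma IS_cell l : IS o vs l = outcome_sum (outcomes l).
Proof. exact: const_valueE (E_neq0 l) (@Sn_cell l). Qed.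

(** The cells are the fibres of the uniformly distributed word [Jbar_word], and
    the sum is constant on each of them. *)
Lemma cdf_S_count t : cdf_S o vs n t
  = (#|[set l | outcome_sum (outcomes l) <= t]%SET|%:R / (card_cells M n)%:R)%:E.
Proof.
have [g gK Kg] := cell_word_bij.
pose Q u := outcome_sum (outcomes (g u)) <= t.
rewrite (_ : #|_| = #|[set u | Q u]%SET|); last first.
  rewrite -(card_imset _ (bij_inj cell_word_bij)); apply: eq_card => u.
  apply/imsetP/idP => [[l + ->]|]; rewrite !inE; first by rewrite /Q gK.
  by move=> Qu; exists (g u); rewrite ?Kg // inE.
rewrite natrX -(lebesgue_measure_digits R Q Jbar_nth_inj Jbar_nth_gt0).
congr lebesgue_measure; apply/seteqP; split=> x /= [x01]; have [l El] := E_cover x01;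
  rewrite (Sn_cell El); have [_ xl] := (E_Jbar_word _ _).1 El;
  by rewrite /Q -/(Jbar_word x) xl gK.
Qed.

End Cells.

Section Outcomes.
Variables (R : realType) (M : nat).

(** Every word of [M.+1] digits occurs at some point, where the variable takes
    one of the enumerated outcomes; so [vs] is onto, between sets of the same
    cardinality. *)
Lemma words_of_outcomes_bij (O : R -> R) (o : 'I_(2 ^ M.+1) -> R)
    (vs : 'I_(2 ^ M.+1) -> M.+1.-tuple bool) :
  increasing_enumeration_of_outcomes O o -> words_of_outcomes O o vs ->
  bijective vs.
Proof.
move=> [_ O_range] hvs.
have succ_inj : injective (fun r : 'I_M.+1 => r.+1) by move=> r r' [/val_inj].
have pre w : exists s, vs s == w.
  have [x x01 <-] := digits_surj R succ_inj (fun=> ltn0Sn _) w.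
  have [s _ os] : range o (O x) by rewrite -O_range; exists x.
  by exists s; rewrite -((hvs x x01 s).1 (esym os)).
have vsK : cancel (fun w => xchoose (pre w)) vs.
  by move=> w; exact/eqP/(xchooseP (pre w)).
apply: (bij_can_bij _ vsK); apply: inj_card_bij; first exact: can_inj vsK.
by rewrite card_tuple card_bool card_ord.
Qed.

End Outcomes.

(** * The quantile function on dyadic cells *)

(** In a sorted sequence the entries that are at most [t] come first. *)
Lemma nth_le_count (R : realDomainType) (s : seq R) (t : R) i :
  sorted <=%R s -> (i < size s)%N -> (nth 0 s i <= t) = (i < count (<= t) s)%N.
Proof.
move=> s_sorted i_s; apply/idP/idP; last exact: nth_count_le.
by apply: contraTT; rewrite -leqNgt -ltNge => le_i; rewrite nth_count_gt ?le_i.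
Qed.

Section Quantile.
Variables (R : realType) (M : nat).
Variables (o : 'I_(2 ^ M.+1) -> R) (vs : 'I_(2 ^ M.+1) -> M.+1.-tuple bool).
Hypothesis vs_bij : bijective vs.
Variable n : nat.
Local Notation C := (card_cells M n).

(** The values of the sum on the cells, with multiplicity, in increasing order:
    the discrete quantile function. *)
Definition sorted_sums : seq R :=
  sort <=%R [seq outcome_sum o (outcomes vs l) | l : 'I_C].

Definition sorted_sum (l : 'I_C) : R := nth 0 sorted_sums l.

Lemma size_sorted_sums : size sorted_sums = C.
Proof. by rewrite size_sort size_map size_enum_ord. Qed.

Lemma sorted_sum_le_count t (l : 'I_C) : (sorted_sum l <= t)
  = (l < #|[set l' : 'I_C | (outcome_sum o (outcomes vs l') <= t)%R]%SET|)%N.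
Proof.
rewrite nth_le_count ?size_sorted_sums ?sort_sorted //; last exact: le_total.
by rewrite card_set_count count_sort count_map.
Qed.

Lemma card_cells_gt0 : 0 < C%:R :> R.
Proof. by rewrite ltr0n expn_gt0. Qed.

(** For [l / C < x <= l.+1 / C], the distribution function at [t] reaches [x]
    exactly when more than [l] cells carry a value at most [t], that is, when [t]
    is at least the value of index [l], counting from 0, in increasing order. *)
Lemma quantile_S_cell (l : 'I_C) x :
  left_endpoint R l < x <= right_endpoint R l -> quantile_S o vs n x = sorted_sum l.
Proof.
rewrite /left_endpoint /right_endpoint ltr_pdivrMr ?card_cells_gt0 //.
rewrite ler_pdivlMr ?card_cells_gt0 // => /andP[lx xl].
rewrite /quantile_S (_ : [set t | _]%classic = `[sorted_sum l, +oo[%classic).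
  by rewrite inf_itv.
apply/seteqP; split=> t; rewrite /= in_itv /= andbT;
  rewrite cdf_S_count // lee_fin ler_pdivlMr ?card_cells_gt0 // sorted_sum_le_count.
  by move=> /(lt_le_trans lx); rewrite ltr_nat.
by move=> l_count; apply: le_trans xl _; rewrite ler_nat.
Qed.

Lemma left_endpoint_inj (l l' : 'I_C) x :
  D l x -> x = left_endpoint R l' -> l' = l.
Proof.
move=> [_ /andP[lx xl]] xE; move: lx xl; rewrite xE /left_endpoint /right_endpoint.
rewrite ler_pM2r ?invr_gt0 ?card_cells_gt0 // ltr_pM2r ?invr_gt0 ?card_cells_gt0 //.
by rewrite ler_nat ltr_nat ltnS => ll' l'l; apply/val_inj/anti_leq; rewrite ll' l'l.
Qed.

Lemma endpoints_lt (l : 'I_C) : left_endpoint R l < right_endpoint R l.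
Proof. by rewrite ltr_pM2r ?invr_gt0 ?card_cells_gt0 // ltr_nat. Qed.

(** On the half-open cell the quantile already has the right value except at
    the left endpoint, which [Sstar] redefines by the value on the interior. *)
Lemma Sstar_cell (l : 'I_C) x : D l x -> Sstar o vs n x = sorted_sum l.
Proof.
move=> Dx; rewrite /Sstar; case: pickP => [l' /eqP/(left_endpoint_inj Dx) ->|no_end].
  apply: const_valueE => [|y /andP[ly yl]].
    exists ((left_endpoint R l + right_endpoint R l) / 2).
    by have [lm mr] := midf_lt (endpoints_lt l); rewrite /= lm mr.
  by apply: quantile_S_cell; rewrite ly ltW.
have [_ /andP[lx xl]] := Dx.
by apply: quantile_S_cell; rewrite lt_neqAle eq_sym no_end lx ltW.
Qed.

Lemma D_neq0 (l : 'I_C) : exists x : R, D l x.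
Proof.
have lr := endpoints_lt l; have [lm mr] := midf_lt lr.
exists ((left_endpoint R l + right_endpoint R l) / 2).
split; last by rewrite ltW.
apply/andP; split.
  by apply: le_lt_trans lm; rewrite divr_ge0.
by apply: lt_le_trans mr _; rewrite ler_pdivrMr ?card_cells_gt0 // mul1r ler_nat.
Qed.

Lemma ISstar_cell (l : 'I_C) : ISstar o vs l = sorted_sum l.
Proof. exact: const_valueE (D_neq0 l) (@Sstar_cell l). Qed.

End Quantile.

(** * Values of the sum and their multiplicities *)

Section Values.
Variables (R : realType) (M : nat) (o : 'I_(2 ^ M.+1) -> R) (n : nat).
Local Notation m := (2 ^ M.+1)%N.
Implicit Type u : n.-tuple 'I_m.

(** How often each outcome occurs in [u], as an element of [K M n]. *)
Definition outcome_counts u : {ffun 'I_m -> 'I_n.+1} := [ffun s => inord (count_mem s u)].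

Lemma outcome_countsE u s : outcome_counts u s = count_mem s u :> nat.
Proof. by rewrite ffunE inordK // ltnS -{2}(size_tuple u) count_size. Qed.

Lemma count_mem_tnth u s : count_mem s u = (\sum_(i < n | tnth u i == s) 1)%N.
Proof. by rewrite -sum1_count big_tuple. Qed.

Lemma outcome_counts_K u : outcome_counts u \in K M n.
Proof.
rewrite inE; apply/eqP.
under eq_bigr => s _ do rewrite outcome_countsE count_mem_tnth.
by rewrite -[RHS](card_ord n) -[RHS]sum1_card [RHS](partition_big (tnth u) xpredT).
Qed.

Lemma dot_outcome_counts u : dot o (outcome_counts u) = outcome_sum o u.
Proof.
rewrite /outcome_sum (partition_big (tnth u) xpredT) //=; apply: eq_bigr => s _.
rewrite outcome_countsE count_mem_tnth natr_sum mulr_suml.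
by apply: eq_bigr => i /eqP ->; rewrite mul1r.
Qed.

Lemma card_outcome_counts k : k \in K M n ->
  #|[set u : n.-tuple 'I_m | outcome_counts u == k]| = multinomial k.
Proof.
rewrite inE => /eqP /card_tuple_counts card_k.
rewrite /multinomial -card_k mulnK ?prodn_gt0 // => [|s]; last exact: fact_gt0.
apply: eq_card => u; rewrite !inE; apply/eqP/forallP => [<- s|uk].
  by rewrite outcome_countsE.
by apply/ffunP => s; apply: val_inj; rewrite /= outcome_countsE; apply/eqP.
Qed.

Lemma card_outcome_sum (P : pred R) : #|[set u : n.-tuple 'I_m | P (outcome_sum o u)]|
  = (\sum_(k in K M n | P (dot o k)) multinomial k)%N.
Proof.
rewrite -sum1dep_card.
rewrite (partition_big outcome_counts (fun k => (k \in K M n) && P (dot o k))) /=.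
  apply: eq_bigr => k /andP[kK Pk]; rewrite -card_outcome_counts // -sum1dep_card.
  apply: eq_bigl => u; case: eqP => [uk|]; rewrite ?andbF // andbT.
  by rewrite -dot_outcome_counts uk.
by move=> u Pu; rewrite outcome_counts_K dot_outcome_counts.
Qed.

Lemma outcome_sum_values u : outcome_sum o u \in values o n.
Proof.
by rewrite mem_sort mem_undup -dot_outcome_counts map_f // mem_enum outcome_counts_K.
Qed.

Lemma dot_values k : k \in K M n -> dot o k \in values o n.
Proof. by move=> kK; rewrite mem_sort mem_undup map_f // mem_enum. Qed.

Lemma values_lt : sorted <%R (values o n).
Proof. by rewrite lt_sorted_uniq_le sort_uniq undup_uniq sort_le_sorted. Qed.

Lemma size_values : size (values o n) = (T o n).+1.
Proof.
rewrite prednK // lt0n size_eq0; apply/eqP => vals0.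
have := outcome_sum_values [tuple of nseq n (Ordinal (num_outcomes_gt0 M))].
by rewrite vals0.
Qed.

Lemma v_lt t t' : (t <= T o n)%N -> (t' <= T o n)%N -> (v o n t < v o n t') = (t < t')%N.
Proof.
by move=> tT t'T; rewrite /v (lt_sorted_ltn_nth _ values_lt) // inE size_values.
Qed.

Lemma v_inj t t' : (t <= T o n)%N -> (t' <= T o n)%N -> v o n t = v o n t' -> t = t'.
Proof.
move=> tT t'T vE; apply/eqP; rewrite -[_ == _]negbK neq_ltn.
by rewrite -(v_lt tT t'T) -(v_lt t'T tT) vE ltxx.
Qed.

Definition value_rank r := index r (values o n).

Lemma value_rank_le r : r \in values o n -> (value_rank r <= T o n)%N.
Proof. by rewrite -ltnS -size_values index_mem. Qed.

Lemma value_rankK r : r \in values o n -> v o n (value_rank r) = r.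
Proof. exact: nth_index. Qed.

Lemma value_rank_eq r t : r \in values o n -> (t <= T o n)%N -> (value_rank r == t) = (r == v o n t).
Proof.
move=> r_val tT; apply/eqP/eqP => [<-|rE]; first by rewrite value_rankK.
by apply: v_inj; rewrite ?value_rank_le // value_rankK.
Qed.

(** Every [dot o k] is one of the listed values, so passing from [t] to [t.+1]
    adds to [Kbar] exactly the [k] with [dot o k = v o n t], also for the last
    [t], where [Kbar o n t.+1] is all of [K M n]. *)
Lemma gamma_card t : (t <= T o n)%N ->
  gamma o n t = #|[set u : n.-tuple 'I_m | outcome_sum o u == v o n t]|.
Proof.
move=> tT; rewrite /gamma.
have KbarS : Kbar o n t.+1 = [set k in K M n | dot o k <= v o n t]%SET.
  apply/setP => k; rewrite /Kbar; case: ifP => [t1T|tT'].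
    rewrite !inE; case: (boolP (\sum_s k s == n)%N) => //= kn.
    have /value_rankK <- : dot o k \in values o n by apply: dot_values; rewrite inE.
    have rk : (value_rank (dot o k) <= T o n)%N by rewrite value_rank_le // dot_values ?inE.
    by rewrite v_lt // leNgt v_lt // -leqNgt ltnS.
  rewrite [RHS]inE; case: (boolP (k \in K M n)) => //= kK; apply/esym.
  have rk := value_rank_le (dot_values kK); rewrite -(value_rankK (dot_values kK)).
  rewrite leNgt v_lt // -leqNgt (leq_trans rk) //.
  by rewrite -ltnS ltnNge; apply: contraFT tT' => /negbNE.
rewrite /SMC KbarS /Kbar tT.
rewrite (eq_bigl (fun k => (k \in K M n) && (dot o k <= v o n t))); last first.
  by move=> k; rewrite [LHS]inE.
rewrite [X in (_ - X)%N](eq_bigl (fun k => (k \in K M n) && (dot o k < v o n t)));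
  last by move=> k; rewrite [LHS]inE.
rewrite -(card_outcome_sum (<= v o n t)) -(card_outcome_sum (< v o n t)) -cardsDS.
  by apply: eq_card => u; rewrite !inE -leNgt andbC -eq_le.
by apply/fintype.subsetP => u; rewrite !inE => /ltW.
Qed.

End Values.

(** * Steps, weights and admissible permutations *)

Section Admissible.
Variables (R : realType) (M : nat).
Variables (o : 'I_(2 ^ M.+1) -> R) (vs : 'I_(2 ^ M.+1) -> M.+1.-tuple bool).
Hypothesis vs_bij : bijective vs.
Variable n : nat.
Local Notation C := (card_cells M n).
Implicit Types l : 'I_C.

Definition cell_sum l : R := outcome_sum o (outcomes vs l).
Local Notation sorted_sum := (@sorted_sum R M o vs n).

Lemma sorted_sums_codom : sorted_sums o vs n = [seq sorted_sum l | l : 'I_C].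
Proof.
rewrite -[LHS](mkseq_nth 0) size_sorted_sums /mkseq -val_enum_ord -map_comp.
exact: eq_map.
Qed.

(** Sorting permutes the values.  This is why steps and weights have the same
    multiplicities. *)
Lemma card_sorted_sum (P : pred R) :
  #|[set l : 'I_C | P (sorted_sum l)]| = #|[set l : 'I_C | P (cell_sum l)]|.
Proof.
rewrite !card_set_count -(count_map sorted_sum) -(count_map cell_sum).
transitivity (count P (sorted_sums o vs n)); first by rewrite sorted_sums_codom.
by rewrite count_sort.
Qed.

Lemma sorted_sum_values l : sorted_sum l \in values o n.
Proof.
have : sorted_sum l \in sorted_sums o vs n.
  by rewrite mem_nth ?size_sorted_sums.
by rewrite mem_sort => /mapP[l' _ ->]; exact: outcome_sum_values.
Qed.

(** [cell_step] and [cell_weight] turn out to be [IStep] and [IWeight]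
    ([IStep_cell], [IWeight_cell]). *)
Definition cell_step l : nat := value_rank o n (sorted_sum l).
Definition cell_weight l : nat := value_rank o n (cell_sum l).

Lemma cell_weight_le l : (cell_weight l <= T o n)%N.
Proof. by rewrite value_rank_le ?outcome_sum_values. Qed.

Lemma cell_step_le l : (cell_step l <= T o n)%N.
Proof. by rewrite value_rank_le ?sorted_sum_values. Qed.

Lemma xget_value_rank (r : R) : r \in values o n ->
  xget 0%N [set t | (t <= T o n)%N /\ r = v o n t]%classic = value_rank o n r.
Proof.
move=> r_val; case: xgetP => [t _ [tT rE]|/(_ (value_rank o n r))[]].
  by apply/esym/eqP; rewrite value_rank_eq // rE.
by rewrite /= value_rank_le // value_rankK.
Qed.

Lemma Step_cell l x : D l x -> Step o vs n x = cell_step l.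
Proof.
by move=> Dx; rewrite /Step (Sstar_cell o vs_bij Dx) xget_value_rank ?sorted_sum_values.
Qed.

Lemma Weight_cell l x : E l x -> Weight o vs n x = cell_weight l.
Proof. by move=> Ex; rewrite /Weight (Sn_cell o vs_bij Ex) xget_value_rank ?outcome_sum_values. Qed.

Lemma IStep_cell l : IStep o vs l = cell_step l.
Proof. exact: const_valueE (D_neq0 R l) (@Step_cell l). Qed.

Lemma IWeight_cell l : IWeight o vs l = cell_weight l.
Proof. exact: const_valueE (E_neq0 R l) (@Weight_cell l). Qed.

Lemma mem_IA t l : (l \in IA o vs n t) = (cell_step l == t).
Proof.
rewrite inE; apply/asboolP/eqP => [DA|lt x Dx].
  by have [x Dx] := D_neq0 R l; have [_ <-] := DA x Dx; rewrite (Step_cell Dx).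
by split; [case: Dx|rewrite (Step_cell Dx)].
Qed.

Lemma mem_IB t l : (l \in IB o vs n t) = (cell_weight l == t).
Proof.
rewrite inE; apply/asboolP/eqP => [EB|lt x Ex].
  by have [x Ex] := E_neq0 R l; have [_ <-] := EB x Ex; rewrite (Weight_cell Ex).
by split; [case: Ex|rewrite (Weight_cell Ex)].
Qed.

(** All cells being nonempty, the universally quantified condition is an
    equality of the constant values. *)
Lemma admissible_sums (pi : {perm 'I_C}) :
  admissible o vs pi <-> forall l, cell_sum (pi l) = sorted_sum l.
Proof.
split=> [adm l|tot l x y Dx Ey].
  have [x Dx] := D_neq0 R l; have [y Ey] := E_neq0 R (pi l).
  have := adm l x y Dx Ey.
  by rewrite (Sstar_cell o vs_bij Dx) (Sn_cell o vs_bij Ey).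
by rewrite (Sstar_cell o vs_bij Dx) (Sn_cell o vs_bij Ey) -tot.
Qed.

Lemma admissible_ranks (pi : {perm 'I_C}) :
  admissible o vs pi <-> forall l, cell_weight (pi l) = cell_step l.
Proof.
rewrite admissible_sums; split=> [tot l|ranks l]; first by rewrite /cell_weight tot.
rewrite -(value_rankK (sorted_sum_values l)) -/(cell_step l) -ranks.
by rewrite value_rankK ?outcome_sum_values.
Qed.

Lemma card_cell_weight t : (t <= T o n)%N -> #|[set l : 'I_C | cell_weight l == t]| = gamma o n t.
Proof.
move=> tT; rewrite gamma_card // -(card_imset _ (bij_inj (outcomes_bij vs_bij n))).
have [g gK Kg] := outcomes_bij vs_bij n.
apply: eq_card => u; apply/imsetP/idP => [[l + ->]|].
  by rewrite !inE value_rank_eq ?outcome_sum_values.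
rewrite inE => ut; exists (g u); rewrite ?Kg //.
by rewrite inE /cell_weight /cell_sum Kg value_rank_eq ?outcome_sum_values.
Qed.

Lemma card_cell_step t : (t <= T o n)%N -> #|[set l : 'I_C | cell_step l == t]| = gamma o n t.
Proof.
move=> tT; rewrite -card_cell_weight //.
exact: (card_sorted_sum (fun r => value_rank o n r == t)).
Qed.

End Admissible.

Theorem lemma1 (R : realType) (M : nat) (O : R -> R)
    (o : 'I_(2 ^ M.+1) -> R) (vs : 'I_(2 ^ M.+1) -> M.+1.-tuple bool)
    (hO : depends_bijectively M O)
    (ho : increasing_enumeration_of_outcomes O o)
    (hvs : words_of_outcomes O o vs)
    (hmean : \sum_s o s = 0)
    (hvar : \sum_s o s ^+ 2 = (2 ^ M.+1)%:R)
    (n : nat) (hn : (0 < n)%N) :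
  [/\ forall t : nat, (t <= T o n)%N ->
        alpha o vs n t = gamma o n t /\ gamma o n t = beta o vs n t,
      forall pi : {perm 'I_(card_cells M n)},
        [/\ admissible o vs pi <->
              (forall l, IWeight o vs (pi l) = IStep o vs l),
            admissible o vs pi <->
              (forall t : nat, (t <= T o n)%N ->
                 [set pi l | l in IA o vs n t]%SET = IB o vs n t)
          & admissible o vs pi <->
              ISstar o vs (n := n) =1 IS o vs (n := n) \o pi]
    & #|[set pi : {perm 'I_(card_cells M n)} | `[< admissible o vs pi >]]%SET|
      = (\prod_(0 <= t < (T o n).+1) (gamma o n t)`!)%N].
Proof.
have vs_bij := words_of_outcomes_bij ho hvs.
split=> [t tT|pi|].
- split.
    rewrite -(card_cell_step vs_bij tT); apply: eq_card => l.
    by rewrite (mem_IA o vs_bij) inE.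
  rewrite -(card_cell_weight vs_bij tT); apply/esym/eq_card => l.
  by rewrite (mem_IB o vs_bij) inE.
- split; rewrite (admissible_ranks o vs_bij).
  + by split=> ranks l; have := ranks l; rewrite IWeight_cell // IStep_cell.
  + split=> [ranks t tT|images l].
      apply/setP => l; rewrite (mem_IB o vs_bij); apply/imsetP/eqP => [[l' + ->]|lt].
        by rewrite (mem_IA o vs_bij) ranks => /eqP.
      exists (pi^-1%g l); rewrite ?permKV // (mem_IA o vs_bij) -ranks permKV.
      exact/eqP.
    have /setP/(_ (pi l)) := images _ (cell_step_le o vs l).
    rewrite mem_imset ?(mem_IB o vs_bij) ?(mem_IA o vs_bij) ?eqxx; last exact: perm_inj.
    by move/esym/eqP.
  + rewrite -(admissible_ranks o vs_bij) admissible_sums //.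
    by split=> tot l; have := tot l; rewrite /= ISstar_cell // IS_cell.
pose g (l : 'I_(card_cells M n)) : 'I_(T o n).+1 := inord (cell_weight o vs l).
pose f (l : 'I_(card_cells M n)) : 'I_(T o n).+1 := inord (cell_step o vs l).
have gE l x : (g l == x) = (cell_weight o vs l == x).
  by rewrite -val_eqE /= inordK // ltnS cell_weight_le.
have fE l x : (f l == x) = (cell_step o vs l == x).
  by rewrite -val_eqE /= inordK // ltnS cell_step_le.
have leT (x : 'I_(T o n).+1) : (x <= T o n)%N by rewrite -ltnS.
have card_g x : #|[set l : 'I_(card_cells M n) | g l == x]%SET| = gamma o n x.
  rewrite -(card_cell_weight vs_bij (leT x)); apply: eq_card => l.
  by rewrite !inE gE.
have card_f x : #|[set l : 'I_(card_cells M n) | f l == x]%SET| = gamma o n x.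
  rewrite -(card_cell_step vs_bij (leT x)); apply: eq_card => l.
  by rewrite !inE fE.
rewrite big_mkord; under [RHS]eq_bigr => x _ do rewrite -card_g.
rewrite -(card_perm_matching (f := f)) => [|x]; last by rewrite card_f card_g.
apply: eq_card => pi; rewrite !inE; apply/asboolP/forallP.
  rewrite admissible_ranks // => ranks l.
  by rewrite gE ranks inordK // ltnS cell_step_le.
move=> ranks; rewrite admissible_ranks // => l.
by have := ranks l; rewrite gE inordK ?ltnS ?cell_step_le // => /eqP.
Qed.
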